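(* Let $K$ and $M$ be simplicial complexes with disjoint vertex sets, with face posets $P_K$ and $P_M$, and let $\tilde{R} \subseteq P_K \times P_M$ be a relation between the face posets. Let $K \star_{\tilde{R}} M$ and $K \times_{\tilde{R}} M$ denote the relational join complex and the relational product complex. Let $p_K : K \times_{\tilde{R}} M \to \|K\|$ be the restriction to the subcomplex $K \times_{\tilde{R}} M$ of the projection map $\|K\| \times \|M\| \to \|K\|$, and let $p_M : K \times_{\tilde{R}} M \to \|M\|$ be the analogous restriction of the projection to $\|M\|$. Then $\|K \star_{\tilde{R}} M\|$ is homeomorphic to the double mapping cylinder of $$\|K\| \xleftarrow{p_K} K \times_{\tilde{R}} M \xrightarrow{p_M} \|M\|.$$
   Context: The face poset $P_K$ of a simplicial complex $K$ is the set of its (non-empty) simplices ordered by inclusion; $\|K\|$ is the geometric realization (with the weak topology). A relation between posets $P$ and $Q$ is a downward closed subset $\tilde{R} \subseteq P \times Q$ (for the product order); write $p\tilde{R}q$ for $(p,q)\in\tilde{R}$. The relational join complex is the abstract simplicial complex $$K \star_{\tilde{R}} M = K \cup M \cup \{\sigma_K \cup \sigma_M \mid \sigma_K \tilde{R} \sigma_M\}.$$ The relational product complex is the regular CW complex $$K \times_{\tilde{R}} M = \bigcup_{\sigma \tilde{R} \tau} \|\sigma\| \times \|\tau\|,$$ a subcomplex of $\|K\| \times \|M\|$, where the product carries the compactly generated CW topology (the weak topology with respect to the closed cells $\|\sigma\| \times \|\tau\|$). The double mapping cylinder of $\|K\| \xleftarrow{p_K} Z \xrightarrow{p_M} \|M\|$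 is the quotient space $\big((Z \times I) \sqcup \|K\| \sqcup \|M\|\big)/\sim$, where $I=[0,1]$ and $\sim$ is generated by $(z,0) \sim p_K(z)$ and $(z,1) \sim p_M(z)$ for $z \in Z$. *)

(* Defs.v *)
From HB Require Import structures.
From Stdlib Require Import Relation_Operators.
From mathcomp Require Import all_boot all_order all_algebra.
From mathcomp Require Import finmap generic_quotient.
From mathcomp Require Import all_classical all_reals all_analysis.

Set Implicit Arguments.
Unset Strict Implicit.
Unset Printing Implicit Defensive.

Import Order.TTheory GRing.Theory Num.Theory.
Import numFieldTopology.Exports numFieldNormedType.Exports.

Local Open Scope classical_set_scope.
Local Open Scope ring_scope.

Definition homeomorphic (X Y : topologicalType) : Prop :=
  exists (f : X -> Y) (g : Y -> X),
    [/\ cancel f g, cancel g f, continuous f & continuous g].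

(* The weak topology on T with respect to a family C of subsets of T: a set is
   open when its trace on every A in C is open in A, where A carries the
   subspace topology inherited from T. *)
Definition weak_topology_of (T : Type) (C : set (set T)) : Type := T.

Section WeakTopology.
Context (T : topologicalType) (C : set (set T)).
Local Notation W := (weak_topology_of C).

Definition weakly_open : set (set W) :=
  [set U | forall A : set T, C A -> open (set_val @^-1` U : set (set_type A))].

Local Lemma weakly_openT : weakly_open setT.
Proof. by move=> A _; rewrite preimage_setT; exact: openT. Qed.

Local Lemma weakly_openI : setI_closed weakly_open.
Proof.
move=> U U' oU oU' A CA; rewrite preimage_setI.
by apply: openI; [exact: oU | exact: oU'].
Qed.

Local Lemma weakly_open_bigcup (I : Type) (U : I -> set W) :
  (forall i, weakly_open (U i)) -> weakly_open (\bigcup_i U i).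
Proof.
move=> oU A CA; rewrite preimage_bigcup.
by apply: bigcup_open => i _; exact: oU.
Qed.

HB.instance Definition _ := Choice.on W.
HB.instance Definition _ :=
  isOpenTopological.Build W weakly_openT weakly_openI weakly_open_bigcup.

End WeakTopology.

Record simplicial_complex (V : choiceType) := SimplicialComplex {
  simplices : set {fset V};
  simplex_neq0 : forall s, simplices s -> s != fset0;
  simplex_face : forall s t : {fset V},
    simplices s -> (t `<=` s)%fset -> t != fset0 -> simplices t
}.

Definition vertices (V : choiceType) (K : simplicial_complex V) : set V :=
  [set v | exists2 s, simplices K s & v \in s].

Definition face_poset (V : choiceType) (K : simplicial_complex V) : Type :=
  set_type (simplices K).

Section FacePoset.
Context (V : choiceType) (K : simplicial_complex V).
Implicit Types s t u : face_poset K.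

Definition face_le s t : bool := (val s `<=` val t)%fset.

Local Lemma face_le_refl : reflexive face_le.
Proof. by move=> s; exact: fsubset_refl. Qed.

Local Lemma face_le_anti : antisymmetric face_le.
Proof. by move=> s t st; apply/val_inj/eqP; rewrite eqEfsubset. Qed.

Local Lemma face_le_trans : transitive face_le.
Proof. by move=> t s u; exact: fsubset_trans. Qed.

HB.instance Definition _ := Choice.on (face_poset K).
HB.instance Definition _ := Order.Le_isPOrder.Build Order.default_display
  (face_poset K) face_le_refl face_le_anti face_le_trans.

End FacePoset.

Record poset_relation d d' (P : porderType d) (Q : porderType d') :=
  PosetRelation {
    related : set (P *p Q);
    related_down_closed : forall a b : P *p Q,
      related b -> (a <= b)%O -> related a
  }.

Section RelationalJoin.
Context (V : choiceType) (K M : simplicial_complex V).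
Context (Rel : poset_relation (face_poset K) (face_poset M)).

Definition join_simplices : set {fset V} :=
  simplices K `|` simplices M `|`
  [set (val p.1 `|` val p.2)%fset | p in related Rel].

Local Lemma join_neq0 (s : {fset V}) : join_simplices s -> s != fset0.
Proof.
case=> [[Ks|Ms]|[[p q] /= _ <-]]; [exact: simplex_neq0 Ks|
  exact: simplex_neq0 Ms|].
have /fset0Pn[v vp] := simplex_neq0 (set_valP p).
by apply/fset0Pn; exists v; rewrite inE vp.
Qed.

Local Lemma join_face (s t : {fset V}) :
  join_simplices s -> (t `<=` s)%fset -> t != fset0 -> join_simplices t.
Proof.
case=> [[Ks|Ms]|[[p q] /= Rpq <-]] ts t0.
- by left; left; exact: simplex_face Ks ts t0.
- by left; right; exact: simplex_face Ms ts t0.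
have tE : t = ((t `&` val p) `|` (t `&` val q))%fset.
  by rewrite -fsetIUr; apply/esym/fsetIidPl.
have [tp0|tp0] := eqVneq (t `&` val p)%fset fset0.
  left; right; apply: simplex_face (set_valP q) _ t0.
  by rewrite tE tp0 fset0U; exact: fsubsetIr.
have [tq0|tq0] := eqVneq (t `&` val q)%fset fset0.
  left; left; apply: simplex_face (set_valP p) _ t0.
  by rewrite tE tq0 fsetU0; exact: fsubsetIr.
have Kp := simplex_face (set_valP p) (fsubsetIr _ _) tp0.
have Mq := simplex_face (set_valP q) (fsubsetIr _ _) tq0.
pose p' : face_poset K := exist (fun u => u \in simplices K) _ (mem_set Kp).
pose q' : face_poset M := exist (fun u => u \in simplices M) _ (mem_set Mq).
right; exists ((p', q') : face_poset K *p face_poset M); last exact/esym.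
apply: related_down_closed Rpq _.
by rewrite leEprod /=; apply/andP; split; exact: fsubsetIr.
Qed.

Definition relational_join : simplicial_complex V :=
  SimplicialComplex join_neq0 join_face.

End RelationalJoin.

Section Realization.
Context (R : realType) (V : choiceType).

(* Barycentric coordinates: finitely supported functions with the topology of
   coordinatewise convergence, which on the functions supported in a fixed
   finite set s is the Euclidean topology of R^s. *)
Definition coordinates (x : {fsfun V -> R with 0}) : {ptws V -> R} := x.

Definition barycentric : Type := initial_topology coordinates.

HB.instance Definition _ := Topological.on barycentric.

Context (K : simplicial_complex V).

Definition realization_points : set barycentric :=
  [set x : {fsfun V -> R with 0} |
    [/\ simplices K (finsupp x), forall v, 0 <= x v
      & \sum_(v <- finsupp x) x v = 1]].

Definition closed_simplex (s : {fset V}) : set (set_type realization_points) :=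
  [set x | finsupp (val x : {fsfun V -> R with 0}) `<=` s]%fset.

Definition realization : Type :=
  weak_topology_of [set closed_simplex s | s in simplices K].

HB.instance Definition _ := Topological.on realization.

End Realization.

Arguments closed_simplex R {V} K s.
Arguments realization R {V} K.

Section RelationalProduct.
Context (R : realType) (V : choiceType) (K M : simplicial_complex V).
Context (Rel : poset_relation (face_poset K) (face_poset M)).

Definition closed_cell (s t : {fset V}) :
    set (realization R K * realization R M) :=
  closed_simplex R K s `*` closed_simplex R M t.

Definition cw_product : Type :=
  weak_topology_of
    [set closed_cell st.1 st.2 | st in simplices K `*` simplices M].

HB.instance Definition _ := Topological.on cw_product.

Definition relational_product_points : set cw_product :=
  \bigcup_(p in related Rel) closed_cell (val p.1) (val p.2).

Definition relational_product : Type := set_type relational_product_points.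

HB.instance Definition _ := Topological.on relational_product.

Definition proj_left (z : relational_product) : realization R K :=
  (val z : realization R K * realization R M).1.

Definition proj_right (z : relational_product) : realization R M :=
  (val z : realization R K * realization R M).2.

End RelationalProduct.

Arguments closed_cell R {V} K M s t.
Arguments cw_product R {V} K M.
Arguments relational_product R {V K M} Rel.
Arguments proj_left R {V K M} Rel z.
Arguments proj_right R {V K M} Rel z.

Section DoubleMappingCylinder.
Context (R : realType) (Z X Y : topologicalType) (f : Z -> X) (g : Z -> Y).

Definition unit_interval : Type := set_type `[0 : R, 1].

HB.instance Definition _ := Topological.on unit_interval.

(* The disjoint union of Z * I, X and Y, as a sigma type over three indices. *)
Definition cylinder_piece (i : option bool) : topologicalType :=
  match i with
  | None => (Z * unit_interval)%type
  | Some true => X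
  | Some false => Y
  end.

Definition cylinder_sum : Type := {i : option bool & cylinder_piece i}.

HB.instance Definition _ := Topological.on cylinder_sum.

Definition in_tube (z : Z) (t : unit_interval) : cylinder_sum :=
  existT cylinder_piece None (z, t).
Definition in_left (x : X) : cylinder_sum :=
  existT cylinder_piece (Some true) x.
Definition in_right (y : Y) : cylinder_sum :=
  existT cylinder_piece (Some false) y.

Inductive cylinder_glue : cylinder_sum -> cylinder_sum -> Prop :=
  | glue_left z (t : unit_interval) :
      val t = 0 -> cylinder_glue (in_tube z t) (in_left (f z))
  | glue_right z (t : unit_interval) :
      val t = 1 -> cylinder_glue (in_tube z t) (in_right (g z)).

Definition cylinder_eqv (a b : cylinder_sum) : bool :=
  `[< clos_refl_sym_trans _ cylinder_glue a b >].

Local Lemma cylinder_eqv_refl : reflexive cylinder_eqv.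
Proof. by move=> a; apply/asboolP; exact: rst_refl. Qed.

Local Lemma cylinder_eqv_sym : symmetric cylinder_eqv.
Proof. by move=> a b; apply/asboolP/asboolP; exact: rst_sym. Qed.

Local Lemma cylinder_eqv_trans : transitive cylinder_eqv.
Proof.
by move=> b a c /asboolP ab /asboolP bc; apply/asboolP; exact: rst_trans ab bc.
Qed.

Definition cylinder_equiv : equiv_rel cylinder_sum :=
  EquivRel cylinder_eqv cylinder_eqv_refl cylinder_eqv_sym cylinder_eqv_trans.

Definition double_mapping_cylinder : Type :=
  quotient_topology {eq_quot cylinder_equiv}%qT.

HB.instance Definition _ := Topological.on double_mapping_cylinder.
HB.instance Definition _ := Quotient.on double_mapping_cylinder.

End DoubleMappingCylinder.

(* Main.v *)
(* The map to the join sends a tube point ((x, y), t) to (1 - t) x + t y and is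
   the inclusion on ||K|| and ||M||. It is bijective because a point of the join
   is determined by its mass t on the vertices of M together with its normalized
   restriction to K (when t is not 1) and to M (when t is not 0). Continuity of
   this map and of its inverse both reduce to compact sets inside the Hausdorff
   space of barycentric coordinates: a subset of a realization is closed iff its
   trace on every closed simplex is closed there, and every closed simplex s u t
   of the join is the image of the compact set (s x t) x I. *)
Require Import Defs.
From HB Require Import structures.
From Stdlib Require Import Relation_Operators.
From mathcomp Require Import all_boot all_order all_algebra.
From mathcomp Require Import finmap generic_quotient.
From mathcomp Require Import all_classical all_reals all_analysis.

Set Implicit Arguments.
Unset Strict Implicit.
Unset Printing Implicit Defensive.

Import Order.TTheory GRing.Theory Num.Theory.
Import numFieldTopology.Exports numFieldNormedType.Exports.

Local Open Scope classical_set_scope.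
Local Open Scope ring_scope.

(** * Compactness, separation and closedness in initial and weak topologies *)

Lemma compact_initial (S : choiceType) (T : topologicalType) (f : S -> T)
    (A : set S) :
  compact (f @` A) -> compact (A : set (initial_topology f)).
Proof.
move=> cfA F PF FA.
have [|_ [[a Aa <-] cla]] := cfA (f @ F) (fmap_proper_filter f PF).
  by apply: (@filterS S F _ A _ _ FA) => x Ax; exists x.
exists a; split=> // B N FB [_ [[G oG <-] Ga GN]].
have [|x [[b Bb <-] Gb]] := cla (f @` B) G _ (open_nbhs_nbhs (conj oG Ga)).
  by apply: (@filterS S F _ B _ _ FB) => x Bx; exists x.
by exists b; split=> //; exact: GN.
Qed.

Lemma initial_hausdorff (S : choiceType) (T : topologicalType) (f : S -> T) :
  injective f -> hausdorff_space T -> hausdorff_space (initial_topology f).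
Proof.
move=> injf hT x y xy; apply/injf/hT => A B fA fB.
have [||z [Az Bz]] := xy (f @^-1` A) (f @^-1` B).
- exact: initial_continuous.
- exact: initial_continuous.
by exists (f z).
Qed.

Lemma continuous_injective_hausdorff (X Y : topologicalType) (f : X -> Y) :
  continuous f -> injective f -> hausdorff_space Y -> hausdorff_space X.
Proof.
move=> cf injf hY x y xy; apply/injf/hY => A B fA fB.
by have [z [Az Bz]] := xy _ _ (cf x _ fA) (cf y _ fB); exists (f z).
Qed.

Section WeakTopologyTheory.
Context (T : topologicalType) (C : set (set T)).
Local Notation W := (weak_topology_of C).

Lemma weak_continuous : continuous (id : W -> T).
Proof.
apply/continuousP => U oU.
suff : weakly_open (U : set W) by [].
by move=> A CA; exists U.
Qed.

Lemma weak_closed (F : set W) :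
  (forall A, C A -> closed (F `&` A : set T)) -> closed F.
Proof.
move=> cF; rewrite -openC.
suff : weakly_open (~` F : set W) by [].
move=> A CA.
exists (~` (F `&` A : set T)); first by rewrite openC; exact: cF.
apply/seteqP; split=> -[x Ax] /=; last by move=> nF -[].
by move=> nFA Fx; apply: nFA; split=> //; exact: set_mem.
Qed.

(** On a member of [C] the weak topology and that of [T] induce the same subspace topology, so a
    cluster point for one is a cluster point for the other. *)
Lemma weak_compact (A : set T) : C A -> compact A -> compact (A : set W).
Proof.
move=> CA cA F PF FA.
have [a [Aa cla]] := cA F PF FA.
exists a; split=> // B N FB; rewrite nbhsE => -[U [oU Ua] UN].
have {}oU : weakly_open (U : set W) by [].
have [G oG GU] := oU A CA.
have Ga : G a.
  suff : (set_val @^-1` G : set (set_type A)) (exist _ a (mem_set Aa)) by [].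
  by rewrite GU.
(* [G] and [U] agree only on [A], so the filter set is first cut down to [A], which belongs to
   [F]. *)
have [b [[Bb Ab] Gb]] := cla (B `&` A) G (filterI FB FA)
  (open_nbhs_nbhs (conj oG Ga)).
exists b; split=> //; apply: UN.
suff : (set_val @^-1` U : set (set_type A)) (exist _ b (mem_set Ab)) by [].
by rewrite -GU.
Qed.

End WeakTopologyTheory.

(** * Barycentric coordinates as a Hausdorff space *)

Section Barycentric.
Context (R : realType) (V : choiceType).
Local Notation B := (barycentric R V).

Definition coef (w : B) : V -> R := coordinates w.

Definition supp (w : B) : {fset V} := finsupp (w : {fsfun V -> R with 0}).

Lemma mem_supp (w : B) v : (v \in supp w) = (coef w v != 0).
Proof. exact: mem_finsupp. Qed.

Lemma coef_eq0 (w : B) (s : {fset V}) v :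
  (supp w `<=` s)%fset -> v \notin s -> coef w v = 0.
Proof.
move=> ws /negP vs; apply/eqP; apply: contra_notT vs => wv.
by apply: (fsubsetP ws); rewrite mem_supp.
Qed.

Lemma coef_inj : injective coef.
Proof. by move=> x y xy; apply/fsfunP => v; move/(congr1 (@^~ v)): xy. Qed.

Lemma coef_continuous v : continuous (coef^~ v).
Proof.
move=> x; apply: (@continuous_comp B {ptws V -> R} R (@coordinates R V)
  (@proj V (fun=> R) v)).
  exact: initial_continuous.
exact: (@proj_continuous V (fun=> R)).
Qed.

Lemma barycentric_hausdorff : hausdorff_space B.
Proof.
apply: initial_hausdorff; first exact: coef_inj.
by apply: hausdorff_product => v; exact: Rhausdorff.
Qed.

Lemma sum_coef (w : B) (s : {fset V}) : (supp w `<=` s)%fset ->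
  \sum_(v <- s) coef w v = \sum_(v <- supp w) coef w v.
Proof.
move=> ws; apply/esym/big_fset_incl => // v _ vw.
exact: coef_eq0 vw.
Qed.

Lemma barycentric_fun (s : {fset V}) (f : V -> R) :
  (forall v, v \notin s -> f v = 0) ->
  exists2 w : B, coef w = f & (supp w `<=` s)%fset.
Proof.
move=> f0; pose w : B := [fsfun v in s => f v | 0].
have wE : coef w = f.
  apply/funext => v; rewrite /coef /coordinates /w fsfunE.
  by case: ifPn => // /f0 ->.
exists w => //; apply/fsubsetP => v; rewrite mem_supp wE.
by apply: contraNT => /f0 ->.
Qed.

Lemma barycentric_continuous (X : topologicalType) (f : X -> B) :
  (forall v, continuous (fun x => coef (f x) v)) -> continuous f.
Proof.
move=> cf; apply: continuous_comp_initial => x.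
apply/cvg_sup => v U [_ [[G oG <-] Gx GU]].
apply: filterS GU _; exact: (cf v x _ (open_nbhs_nbhs (conj oG Gx))).
Qed.

End Barycentric.
Arguments coef {R V} w v.

(** * Geometric realization and its closed simplices *)

Section RealizationTheory.
Context (R : realType) (V : choiceType) (K : simplicial_complex V).
Local Notation B := (barycentric R V).
Local Notation X := (realization R K).
Implicit Types (s : {fset V}) (x : X).

Definition bary x : B := val (x : set_type (realization_points K)).

Lemma bary_inj : injective bary.
Proof. exact: val_inj. Qed.

Lemma bary_continuous : continuous bary.
Proof.
move=> x; apply: (@continuous_comp X (set_type (realization_points K)) B).
  exact: weak_continuous.
exact: initial_continuous.
Qed.

Lemma bary_coef_continuous v : continuous (fun x => coef (bary x) v).
Proof.
move=> x; apply: (@continuous_comp X B R bary (coef^~ v)).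
  exact: bary_continuous.
exact: coef_continuous.
Qed.

Lemma realization_hausdorff : hausdorff_space X.
Proof.
apply: (@continuous_injective_hausdorff X B bary).
- exact: bary_continuous.
- exact: bary_inj.
- exact: barycentric_hausdorff.
Qed.

Lemma baryP x : realization_points K (bary x).
Proof. exact: (set_valP (x : set_type (realization_points K))). Qed.

Lemma supp_simplex x : simplices K (supp (bary x)).
Proof. by case: (baryP x). Qed.

Lemma coef_ge0 x v : 0 <= coef (bary x) v.
Proof. by case: (baryP x) => _ + _; apply. Qed.

Lemma sum_coef1 x s : (supp (bary x) `<=` s)%fset ->
  \sum_(v <- s) coef (bary x) v = 1.
Proof.
move=> /sum_coef ->.
by case: (baryP x).
Qed.

Lemma realizationP s (f : V -> R) : simplices K s ->
    (forall v, 0 <= f v) -> (forall v, v \notin s -> f v = 0) ->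
    \sum_(v <- s) f v = 1 ->
  exists2 x : X, coef (bary x) = f & closed_simplex R K s x.
Proof.
move=> Ks f_ge0 f0; have [w wf ws] := barycentric_fun f0; subst f.
rewrite (sum_coef ws) => f1.
have Kw : realization_points K w.
  (* A face must be non-empty: an empty support would give total mass 0 instead of 1. *)
  split=> //; apply: simplex_face Ks ws _; apply/eqP => w0.
  by move: f1; rewrite -/(supp w) w0 big_seq_fset0 => /esym/eqP;
    rewrite oner_eq0.
by exists (exist _ w (mem_set Kw) : set_type (realization_points K)).
Qed.

(** In coordinates the simplex is a Tychonoff cube, with unit interval factors on [s] and the single
    point 0 elsewhere, cut by the closed condition that the coordinates over [s] sum to 1. *)
Lemma compact_closed_simplex s :
  simplices K s -> compact (closed_simplex R K s : set X).
Proof.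
move=> Ks; apply: weak_compact; first by exists s.
(* Two initial topologies are peeled off: the subspace of [barycentric], then [coordinates] into the
   function space. *)
apply/compact_initial/compact_initial.
pose I v : set R := `[0, (if v \in s then 1 else 0 : R)]%classic.
have cI : compact ([set f | forall v, I v (f v)] : set {ptws V -> R}).
  by apply: tychonoff => v; exact: segment_compact.
have cS : closed ([set f | \sum_(v <- s) f v = 1] : set {ptws V -> R}).
  apply: (@preimage_closed {ptws V -> R} R (fun f => \sum_(v <- s) f v)
    [set x | x = 1]).
    move=> f _; apply: continuous_big => [|v _]; first exact: add_continuous.
    exact: (@proj_continuous V (fun=> R)).
  exact: closed_eq.
apply: eq_ind (compact_closedI cI cS) _ _; apply/seteqP; split.
  move=> f [/= If f1].
  have f0 v : v \notin s -> f v = 0.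
    move=> /negPf vs; have := If v; rewrite /I /= vs in_itv /=.
    by move=> fv; apply/eqP; rewrite eq_le andbC.
  have f_ge0 v : 0 <= f v.
    by have := If v; rewrite /I /= in_itv /= => /andP[].
  have [x xf xs] := realizationP Ks f_ge0 f0 f1.
  by exists (bary x) => //; exists x.
move=> _ [_ [x xs <-] <-].
split; last exact: sum_coef1.
move=> v; rewrite /I /= in_itv /=; apply/andP; split; first exact: coef_ge0.
case: ifPn => [vs|]; last by move=> /(coef_eq0 xs) <-.
rewrite -(sum_coef1 xs) (big_fsetD1 v) //= lerDl.
by apply: sumr_ge0 => u _; exact: coef_ge0.
Qed.

(** [barycentric] is shared by [K], [M] and their join, so traces of sets from different
    realizations become comparable. Forward, traces are compact and hence closed in a Hausdorff
    space; backward, they are recovered as preimages. *)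
Lemma closed_realizationP (F : set X) :
  closed F <-> forall s, simplices K s ->
    closed (bary @` (F `&` closed_simplex R K s)).
Proof.
split=> [cF s Ks|cF].
  apply: compact_closed; first exact: barycentric_hausdorff.
  apply: continuous_compact; first exact/continuous_subspaceT/bary_continuous.
  by rewrite setIC; apply: compact_closedI => //; exact: compact_closed_simplex.
apply: weak_closed => _ [s Ks <-].
rewrite (_ : _ `&` _ = set_val @^-1` (bary @` (F `&` closed_simplex R K s))).
  apply: preimage_closed (cF s Ks) => x _; exact: initial_continuous.
apply/seteqP; split=> x /=; first by exists x.
by move=> [y Fy /val_inj <-].
Qed.

End RealizationTheory.
Arguments bary {R V K} x.
Arguments bary_inj {R V K}.

(** * Inclusion of a subcomplex *)

Section Inclusion.
Context (R : realType) (V : choiceType) (K L : simplicial_complex V).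
Hypothesis KL : simplices K `<=` simplices L.

Lemma inclusion_subproof (x : realization R K) : realization_points L (bary x).
Proof. by case: (baryP x) => Kx x_ge0 x1; split=> //; exact: KL. Qed.

Definition inclusion (x : realization R K) : realization R L :=
  (exist _ (bary x) (mem_set (inclusion_subproof x)) :
    set_type (realization_points L)).

Lemma bary_inclusion x : bary (inclusion x) = bary x.
Proof. by []. Qed.

(** A point of the larger realization supported in a simplex of [K] already comes from [K]. This
    moves the closedness test on simplices of [K] between the two realizations, in both
    directions. *)
Lemma image_inclusion (F : set (realization R L)) s : simplices K s ->
  bary @` (F `&` closed_simplex R L s) =
  bary @` (inclusion @^-1` F `&` closed_simplex R K s).
Proof.
move=> Ks; apply/seteqP; split=> _ [x [Fx xs] <-]; last first.
  by exists (inclusion x).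
have [y yx ys] : exists2 y : realization R K,
    coef (bary y) = coef (bary x) & closed_simplex R K s y.
  apply: realizationP => //; first exact: coef_ge0.
    by move=> v; exact: coef_eq0.
  exact: sum_coef1.
exists y; last exact: coef_inj.
split=> //; suff yx' : inclusion y = x by rewrite /preimage /= yx'.
by apply/bary_inj/coef_inj.
Qed.

Lemma inclusion_continuous : continuous inclusion.
Proof.
apply/continuous_closedP => F /closed_realizationP cF.
apply/closed_realizationP => s Ks.
by rewrite -image_inclusion //; apply: cF; exact: KL.
Qed.

End Inclusion.

(* Whitehead's lemma that [Z * I] carries the weak topology of the cells
   [c * I]: cut [I] down to a compact neighbourhood [N] of the given point and
   project the compact sets [P `&` (c `*` N)] to [Z]. *)
Lemma coherent_prod_closed (Z I : topologicalType) (C : set (set Z)) :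
    hausdorff_space I -> compact [set: I] ->
    (forall z, exists2 c, C c & c z) -> (forall c, C c -> compact c) ->
    (forall S : set Z, (forall c, C c -> compact (S `&` c)) -> closed S) ->
  forall P : set (Z * I),
    (forall c, C c -> closed (P `&` (c `*` setT))) -> closed P.
Proof.
move=> hI cI covC cptC cohC P cP; rewrite -openC openE => -[z t] /= nP.
have [c0 Cc0 c0z] := covC z.
pose slice n := (z, n) : Z * I.
have slice_cont : continuous slice.
  by move=> n; apply: cvg_pair; [exact: cvg_cst | exact: cvg_id].
have cQ : closed (slice @^-1` (P `&` (c0 `*` setT))).
  by apply: preimage_closed (cP _ Cc0) => n _; exact: slice_cont.
have nbQ : nbhs t (~` (slice @^-1` (P `&` (c0 `*` setT)))).
  by apply: open_nbhs_nbhs; split; [rewrite openC | case].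
have [N tN NQ] := compact_regular hI cI filterT nbQ.
pose S := [set z' | exists2 n, closure N n & P (z', n)].
have cS : closed S.
  apply: cohC => c Cc.
  have -> : S `&` c = fst @` ((c `*` closure N) `&` (P `&` (c `*` setT))).
    apply/seteqP; split=>
      [z' [[n Nn Pn] cz']|_ [[z' n] [[/= cz' Nn] [Pn _]] <-]].
      by exists (z', n).
    by split=> //; exists n.
  apply: continuous_compact.
    by apply: continuous_subspaceT => u; exact: cvg_fst.
  apply: compact_closedI (cP _ Cc).
  apply: compact_setX; first exact: cptC.
  by apply: subclosed_compact cI _ => //; exact: closed_closure.
exists (~` S, N) => /=.
  split=> //; apply: open_nbhs_nbhs; split; first by rewrite openC.
  by case=> n Nn Pn; exact: (NQ _ Nn).
move=> [z' n] [/= nS Nn] Pn; apply: nS; exists n => //.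
exact: subset_closure.
Qed.

(** * The relational product and its cells *)

Section RelationalProductTheory.
Context (R : realType) (V : choiceType) (K M : simplicial_complex V).
Context (Rel : poset_relation (face_poset K) (face_poset M)).
Local Notation Z := (relational_product R Rel).
Local Notation X := (realization R K).
Local Notation Y := (realization R M).
Implicit Types (s t : {fset V}).

(** Stated on bare finite sets, so that supports of points can be compared without membership
    proofs. *)
Definition related_simplices s t : Prop :=
  exists p, [/\ related Rel p, val p.1 = s & val p.2 = t].

Lemma related_simplicesW s t :
  related_simplices s t -> simplices K s /\ simplices M t.
Proof. by case=> p [_ <- <-]; split; exact: set_valP. Qed.

Lemma related_simplices_face s t s' t' : related_simplices s t ->
    (s' `<=` s)%fset -> (t' `<=` t)%fset -> simplices K s' -> simplices M t' ->
  related_simplices s' t'.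
Proof.
move=> [p [Rp ps pt]] ss tt Ks Mt.
pose p1 : face_poset K := exist (fun u => u \in simplices K) _ (mem_set Ks).
pose p2 : face_poset M := exist (fun u => u \in simplices M) _ (mem_set Mt).
exists ((p1, p2) : face_poset K *p face_poset M); split=> //.
apply: related_down_closed Rp _.
rewrite leEprod; apply/andP; split.
  by rewrite /Order.le /= /face_le ps.
by rewrite /Order.le /= /face_le pt.
Qed.

(** The target carries the plain product topology, possibly coarser than the CW one; it serves as a
    Hausdorff space in which compact images of cells are closed. *)
Definition components (z : Z) : X * Y :=
  (proj_left R Rel z, proj_right R Rel z).

Lemma components_inj : injective components.
Proof.
move=> z z' zz'; apply: val_inj.
move: zz'; rewrite /components /proj_left /proj_right.
by case: (val z) (val z') => a b [].
Qed.

Lemma componentsE z : components z = val z.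
Proof. by rewrite /components /proj_left /proj_right; case: (val z). Qed.

Lemma components_continuous : continuous components.
Proof.
have -> : components = val by apply/funext => z; exact: componentsE.
move=> z; apply: (@continuous_comp Z (cw_product R K M) (X * Y)%type
  (val : Z -> cw_product R K M) id).
  exact: initial_continuous.
exact: weak_continuous.
Qed.

Definition cell s t : set Z := components @^-1` closed_cell R K M s t.

Lemma exists_components s t (xy : X * Y) :
  related_simplices s t -> closed_cell R K M s t xy ->
  exists z, components z = xy.
Proof.
move=> [p [Rp ps pt]] cxy.
have Zxy : relational_product_points Rel xy by exists p => //; rewrite ps pt.
exists (exist _ xy (mem_set Zxy)).
exact: componentsE.
Qed.

(** Some related pair of simplices carries [z], and the two supports are faces of it, so downward
    closure of the relation applies. *)
Lemma related_components z :
  related_simplices (supp (bary (components z).1))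
    (supp (bary (components z).2)).
Proof.
have : relational_product_points Rel (val z) by exact: set_valP.
rewrite -componentsE => -[p Rp [/= zp1 zp2]].
have Rp' : related_simplices (val p.1) (val p.2) by exists p.
by apply: related_simplices_face Rp' zp1 zp2 _ _; exact: supp_simplex.
Qed.

Lemma cell_cover z : exists s t, related_simplices s t /\ cell s t z.
Proof.
exists (supp (bary (components z).1)), (supp (bary (components z).2)).
split; first exact: related_components.
by split; exact: fsubset_refl.
Qed.

Lemma image_cell s t : related_simplices s t ->
  components @` cell s t = closed_cell R K M s t.
Proof.
move=> Rst; apply/seteqP; split=> [_ [z zst <-] //|xy cxy].
have [z zxy] := exists_components Rst cxy.
by exists z => //; rewrite /cell /preimage /= zxy.
Qed.

Lemma compact_closed_cell s t : simplices K s -> simplices M t ->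
  compact (closed_cell R K M s t).
Proof. by move=> Ks Mt; apply: compact_setX; exact: compact_closed_simplex. Qed.

(** Every point of the closed cell of a related pair lies in [Z], so the cell is a full product of
    two compact simplices; the weak topology keeps it compact. *)
Lemma compact_cell s t : related_simplices s t -> compact (cell s t).
Proof.
move=> Rst; have [Ks Mt] := related_simplicesW Rst.
apply: compact_initial.
have -> : set_val @` cell s t = closed_cell R K M s t.
  by rewrite -(image_cell Rst); apply/eq_imagel => z _; rewrite componentsE.
apply: weak_compact; last exact: compact_closed_cell.
by exists (s, t).
Qed.

Lemma product_hausdorff : hausdorff_space (X * Y)%type.
Proof.
move=> [x y] [x' y'] xy; congr (_, _).
  apply: realization_hausdorff => A B xA yB.
  have [||z [Az Bz]] := xy (fst @^-1` A) (fst @^-1` B); [exact: cvg_fst..|].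
  by exists z.1.
apply: realization_hausdorff => A B xA yB.
have [||z [Az Bz]] := xy (snd @^-1` A) (snd @^-1` B); [exact: cvg_snd..|].
by exists z.2.
Qed.

(** The weak topology on the ambient product tests all cells, related or not. The trace on an
    arbitrary cell is the finite union of the traces on its related faces, each compact and so
    closed. *)
Lemma cell_coherent (S : set Z) :
  (forall s t, related_simplices s t -> compact (S `&` cell s t)) -> closed S.
Proof.
move=> cS; pose F : set (cw_product R K M) := components @` S.
have -> : S = set_val @^-1` F.
  apply/seteqP; split=> z /=; first by exists z => //; exact: componentsE.
  by case=> z' Sz'; rewrite componentsE => /val_inj <-.
suff cF : closed F.
  by apply: preimage_closed cF => z _; exact: initial_continuous.
apply: weak_closed => _ [[s t] [/= Ks Mt] <-].
(* [G u w] is empty for unrelated [u] and [w], which lets the unions run over all subsets of [s] and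
   [t]. *)
pose G u w : set (X * Y) :=
  [set q | related_simplices u w /\ (components @` (S `&` cell u w)) q].
have -> : F `&` closed_cell R K M s t =
    \bigcup_(u in [set` fpowerset s]) \bigcup_(w in [set` fpowerset t]) G u w.
  apply/seteqP; split.
    move=> _ [[z Sz <-] [zs zt]].
    exists (supp (bary (components z).1)); first by rewrite /= fpowersetE.
    exists (supp (bary (components z).2)); first by rewrite /= fpowersetE.
    split; first exact: related_components.
    by exists z => //; split=> //; split; exact: fsubset_refl.
  move=> q [u /=]; rewrite fpowersetE => us [w /=]; rewrite fpowersetE => wt.
  move=> [_ [z [Sz [zu zw]] <-]]; split; first by exists z.
  by split; [exact: fsubset_trans us | exact: fsubset_trans wt].
apply: closed_bigcup => [|u _]; first exact: finite_fset.
apply: closed_bigcup => [|w _]; first exact: finite_fset.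
have [Ruw|nRuw] := pselect (related_simplices u w); last first.
  by rewrite (_ : G u w = set0); [exact: closed0 | apply/seteqP; split=> q []].
have -> : G u w = components @` (S `&` cell u w).
  by apply/seteqP; split=> q //; case.
apply: compact_closed; first exact: product_hausdorff.
apply: continuous_compact; last exact: cS.
exact/continuous_subspaceT/components_continuous.
Qed.

Lemma closed_cell_tube (I : topologicalType) (P : set (Z * I)) :
    hausdorff_space I -> compact [set: I] ->
    (forall s t, related_simplices s t -> closed (P `&` (cell s t `*` setT))) ->
  closed P.
Proof.
move=> hI cI cP.
pose C := [set c | exists s t, related_simplices s t /\ c = cell s t].
apply: (@coherent_prod_closed Z I C) => //.
- by move=> z; have [s [t [Rst zst]]] := cell_cover z;
    exists (cell s t) => //; exists s, t.
- by move=> _ [s [t [Rst ->]]]; exact: compact_cell.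
- by move=> S cS; apply: cell_coherent => s t Rst; apply: cS; exists s, t.
- by move=> _ [s [t [Rst ->]]]; exact: cP.
Qed.

End RelationalProductTheory.
Arguments components {R V K M Rel} z.
Arguments cell {R V K M} Rel s t _.

(** * Rescaling barycentric coordinates *)

Section Coordinates.
Context (R : realType) (V : choiceType) (K : simplicial_complex V).
Implicit Types x : realization R K.

Lemma coef_nonvertex x v : ~ vertices K v -> coef (bary x) v = 0.
Proof.
move=> nKv; apply/eqP/negPn/negP; rewrite -mem_supp => xv; apply: nKv.
by exists (supp (bary x)) => //; exact: supp_simplex.
Qed.

Lemma exists_coef_neq0 x : exists2 v, vertices K v & coef (bary x) v != 0.
Proof.
have Kx := supp_simplex x.
have /fset0Pn[v xv] := simplex_neq0 Kx.
by exists v; [exists (supp (bary x)) | rewrite -mem_supp].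
Qed.

(** Summing the coordinates, which total 1 for both points, recovers the factors; a nonzero factor
    can then be cancelled. *)
Lemma scaled_coef_inj x x' (a b : R) :
    (forall v, a * coef (bary x) v = b * coef (bary x') v) ->
  a = b /\ (a != 0 -> x = x').
Proof.
move=> axbx'; have ab : a = b.
  have xs := fsubsetUl (supp (bary x)) (supp (bary x')).
  have x's := fsubsetUr (supp (bary x)) (supp (bary x')).
  rewrite -[a]mulr1 -[b]mulr1 -{1}(sum_coef1 xs) -(sum_coef1 x's) !mulr_sumr.
  exact: eq_bigr.
split=> // a0; apply/bary_inj/coef_inj/funext => v; apply: (mulfI a0).
by rewrite axbx' ab.
Qed.

(** Multiplying by the total mass instead of dividing by it keeps the statement meaningful when [f]
    vanishes on [s], where any point of the simplex will do. *)
Lemma exists_normalized s (f : V -> R) :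
    simplices K s -> (forall v, 0 <= f v) ->
  exists2 x : realization R K, closed_simplex R K s x &
    forall v, v \in s -> (\sum_(u <- s) f u) * coef (bary x) v = f v.
Proof.
move=> Ks f_ge0; set m := \sum_(u <- s) f u.
have [m0|m0] := eqVneq m 0.
  (* Zero mass: an arbitrary vertex of [s] serves as the point. *)
  have /fset0Pn[v0 sv0] := simplex_neq0 Ks.
  have [||||x _ xs] := @realizationP R V K s (fun v => (v == v0)%:R).
  - exact: Ks.
  - by move=> v; exact: ler0n.
  - by move=> v; apply: contraNeq; rewrite pnatr_eq0 eqb0 negbK => /eqP ->.
  - rewrite (big_fsetD1 v0) //= eqxx big1_fset ?addr0 // => v.
    by rewrite !inE => /andP[/negPf ->].
  exists x => // v sv; rewrite m0 mul0r; apply/esym/eqP.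
  rewrite eq_le f_ge0 andbT -m0 /m (big_fsetD1 v) //= lerDl.
  by apply: sumr_ge0 => u _; exact: f_ge0.
have m_ge0 : 0 <= m by apply: sumr_ge0 => u _; exact: f_ge0.
have [||||x xf xs] :=
    @realizationP R V K s (fun v => if v \in s then f v / m else 0).
- exact: Ks.
- by move=> v; case: ifP => // _; rewrite divr_ge0.
- by move=> v /negPf ->.
- rewrite big_seq_cond (eq_bigr (fun v => f v / m)) => [|v /andP[-> //]].
  by rewrite -big_seq_cond -mulr_suml divff.
by exists x => // v sv; rewrite xf sv mulrC divfK.
Qed.

End Coordinates.

Lemma big_fsetU_disjoint (V : choiceType) (R : realType) (s t : {fset V})
    (f : V -> R) : (forall v, v \in s -> v \notin t) ->
  \sum_(v <- (s `|` t)%fset) f v = \sum_(v <- s) f v + \sum_(v <- t) f v.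
Proof.
move=> st; rewrite (big_fsetID _ (mem s)) /=.
congr (_ + _); apply: eq_fbigl => v.
  by rewrite !inE /=; case: (v \in s); rewrite ?andbF.
rewrite !inE /=; case: (boolP (v \in s)) => [/st/negPf -> //|_].
by rewrite /= andbT.
Qed.

(** * The unit interval as a compact Hausdorff space *)

Section UnitInterval.
Context (R : realType).

Lemma unit_interval_compact : compact [set: unit_interval R].
Proof.
apply: compact_initial.
rewrite (_ : _ @` _ = `[0 : R, 1]%classic); first exact: segment_compact.
apply/seteqP; split=> [_ [t _ <-]|t t01]; first exact: set_valP.
by exists (exist _ t (mem_set t01)).
Qed.

Lemma unit_interval_hausdorff : hausdorff_space (unit_interval R).
Proof. by apply: initial_hausdorff; [exact: val_inj | exact: Rhausdorff]. Qed.

Lemma unit_interval_continuous : continuous (val : unit_interval R -> R).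
Proof. exact: initial_continuous. Qed.

Lemma unit_intervalP (t : unit_interval R) : 0 <= val t <= 1.
Proof. by have := set_valP t; rewrite /= in_itv. Qed.

End UnitInterval.

(** * The continuous map from the cylinder to the join *)

Section CylinderToJoin.
Context (R : realType) (V : choiceType) (K M : simplicial_complex V).
Context (Rel : poset_relation (face_poset K) (face_poset M)).
Local Notation L := (relational_join Rel).
Local Notation J := (realization R L).
Local Notation Z := (relational_product R Rel).
Local Notation I := (unit_interval R).
Local Notation X := (realization R K).
Local Notation Y := (realization R M).
Implicit Types (s t : {fset V}).

Lemma join_left : simplices K `<=` simplices L.
Proof. by move=> s Ks; left; left. Qed.

Lemma join_right : simplices M `<=` simplices L.
Proof. by move=> s Ms; left; right. Qed.

Lemma join_related s t :
  related_simplices Rel s t -> simplices L (s `|` t)%fset.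
Proof. by move=> [p [Rp <- <-]]; right; exists p. Qed.

Definition segment_coef (zi : Z * I) (v : V) : R :=
  (1 - val zi.2) * coef (bary (components zi.1).1) v
  + val zi.2 * coef (bary (components zi.1).2) v.

Lemma segment_subproof zi : exists w : J, coef (bary w) = segment_coef zi.
Proof.
case: zi => z i; have /andP[i_ge0 i_le1] := unit_intervalP i.
set s := supp (bary (components z).1); set t := supp (bary (components z).2).
have [||||w wE _] := @realizationP R V L (s `|` t)%fset (segment_coef (z, i)).
- exact/join_related/related_components.
- by move=> v; rewrite addr_ge0 // mulr_ge0 ?subr_ge0 // coef_ge0.
- move=> v; rewrite inE negb_or => /andP[vs vt].
  by rewrite /segment_coef (coef_eq0 _ vs) // (coef_eq0 _ vt) // !mulr0 addr0.
- rewrite big_split /= -!mulr_sumr !sum_coef1 ?fsubsetUl ?fsubsetUr //.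
  by rewrite !mulr1 subrK.
by exists w.
Qed.

(** The chosen point is unique, since its coordinates determine it. *)
Definition segment (zi : Z * I) : J := sval (cid (segment_subproof zi)).

Lemma coef_segment zi : coef (bary (segment zi)) = segment_coef zi.
Proof. exact: svalP (cid (segment_subproof zi)). Qed.

Lemma segment_cell s t z i :
  cell Rel s t z -> closed_simplex R L (s `|` t)%fset (segment (z, i)).
Proof.
move=> [zs zt]; apply/fsubsetP => v.
rewrite mem_supp coef_segment; apply: contraNT.
rewrite inE negb_or => /andP[vs vt].
by rewrite /segment_coef (coef_eq0 zs vs) (coef_eq0 zt vt) !mulr0 addr0.
Qed.

(** Only coordinatewise continuity; the weak topology of the join is reached in
    [segment_continuous]. *)
Lemma bary_segment_continuous : continuous (bary \o segment).
Proof.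
apply: barycentric_continuous => v.
have -> : (fun zi => coef ((bary \o segment) zi) v) = segment_coef^~ v.
  by apply/funext => zi; rewrite /= coef_segment.
have cval : continuous (fun zi : Z * I => val zi.2 : R).
  move=> zi; apply: (@continuous_comp _ I R snd val); first exact: cvg_snd.
  exact: unit_interval_continuous.
have cpt : continuous (fun zi : Z * I => components zi.1).
  move=> zi; apply: (@continuous_comp _ Z _ fst (@components R V K M Rel)).
    exact: cvg_fst.
  exact: components_continuous.
have cl : continuous (fun zi : Z * I => coef (bary (components zi.1).1) v).
  move=> zi; apply: (@continuous_comp _ X R (fun zi => (components zi.1).1)
    (fun x => coef (bary x) v)).
    apply: (@continuous_comp _ (X * Y)%type X (fun zi => components zi.1) fst).
      exact: cpt.
    exact: cvg_fst.
  exact: bary_coef_continuous.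
have cr : continuous (fun zi : Z * I => coef (bary (components zi.1).2) v).
  move=> zi; apply: (@continuous_comp _ Y R (fun zi => (components zi.1).2)
    (fun x => coef (bary x) v)).
    apply: (@continuous_comp _ (X * Y)%type Y (fun zi => components zi.1) snd).
      exact: cpt.
    exact: cvg_snd.
  exact: bary_coef_continuous.
move=> zi; apply: cvgD; apply: cvgM; [|exact: cl|exact: cval|exact: cr].
by apply: cvgB; [exact: cvg_cst | exact: cval].
Qed.

(** The tube over [cell s t] lands in a single closed simplex of the join, where closedness is
    visible in barycentric coordinates; [closed_cell_tube] assembles the cells. *)
Lemma segment_continuous : continuous segment.
Proof.
apply/continuous_closedP => F /closed_realizationP cF.
apply: closed_cell_tube.
- exact: unit_interval_hausdorff.
- exact: unit_interval_compact.
move=> s t Rst.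
set c := cell Rel s t `*` setT.
have -> : segment @^-1` F `&` c =
    (bary \o segment) @^-1` (bary @` (F `&` closed_simplex R L (s `|` t)%fset))
    `&` c.
  apply/seteqP; split=> -[z i] [] /= Fzi [zst _]; split=> //.
    by exists (segment (z, i)) => //; split=> //; exact: segment_cell.
  by case: Fzi => w [Fw _] /bary_inj <-.
apply: closedI.
  apply: preimage_closed => [zi _|]; first exact: bary_segment_continuous.
  by apply: cF; exact: join_related.
(* The cell is closed in [Z]: it is the preimage under [components] of a compact, hence closed,
   set. *)
have -> : c = fst @^-1` cell Rel s t by apply/seteqP; split=> -[z i] // [].
apply: preimage_closed => [zi _|]; first exact: cvg_fst.
have [Ks Mt] := related_simplicesW Rst.
have -> : cell Rel s t = components @^-1` closed_cell R K M s t by [].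
apply: preimage_closed => [z _|]; first exact: components_continuous.
apply: compact_closed; first exact: product_hausdorff.
exact: compact_closed_cell.
Qed.

Local Notation S := (cylinder_sum R Z X Y).
Local Notation D :=
  (double_mapping_cylinder R (proj_left R Rel) (proj_right R Rel)).

Local Open Scope quotient_scope.

Definition sum_to_join : S -> J := unstable.sigT_fun
  (fun i => match i return cylinder_piece R Z X Y i -> J with
            | None => segment
            | Some true => inclusion join_left
            | Some false => inclusion join_right
            end).

Lemma sum_to_join_continuous : continuous sum_to_join.
Proof.
apply: sigT_continuous => -[[]|].
- exact: inclusion_continuous.
- exact: inclusion_continuous.
- exact: segment_continuous.
Qed.

Local Notation glued :=
  (clos_refl_sym_trans _
    (cylinder_glue (R := R) (proj_left R Rel) (proj_right R Rel))).

(** Only the two generators need computation: at either end of the tube one of the weights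
    vanishes. *)
Lemma sum_to_join_glue a b : glued a b -> sum_to_join a = sum_to_join b.
Proof.
elim=> {a b} [_ _ [z i i0|z i i1]|//|a b _ //|a b c _ -> _ -> //].
  apply/bary_inj/coef_inj; rewrite coef_segment; apply/funext => v.
  by rewrite /segment_coef /= i0 subr0 mul1r mul0r addr0.
apply/bary_inj/coef_inj; rewrite coef_segment; apply/funext => v.
by rewrite /segment_coef /= i1 subrr mul1r mul0r add0r.
Qed.

Lemma piE (a b : S) : \pi_D a = \pi_D b <-> glued a b.
Proof.
split=> [/eqmodP/asboolP //|ab].
by apply/eqmodP/asboolP.
Qed.

Definition cylinder_to_join : D -> J := sum_to_join \o repr.

Lemma cylinder_to_join_pi a : cylinder_to_join (\pi_D a) = sum_to_join a.
Proof. by apply: sum_to_join_glue; apply/piE; rewrite reprK. Qed.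

Lemma cylinder_to_join_continuous : continuous cylinder_to_join.
Proof.
apply/quotient_continuous.
have -> : cylinder_to_join \o \pi_D = sum_to_join.
  by apply/funext => a; exact: cylinder_to_join_pi.
exact: sum_to_join_continuous.
Qed.

(** * Injectivity, from disjointness of the vertex sets *)

Hypothesis disjointKM : vertices K `&` vertices M = set0.

Local Notation inL := (@in_left R Z X Y).
Local Notation inR := (@in_right R Z X Y).
Local Notation tube := (@in_tube R Z X Y).

Lemma disjoint_vertices v : vertices K v -> ~ vertices M v.
Proof.
move=> Kv Mv; have : (vertices K `&` vertices M) v by [].
by rewrite disjointKM.
Qed.

Lemma coef_left_vertex (y : Y) v : vertices K v -> coef (bary y) v = 0.
Proof. by move=> /disjoint_vertices; exact: coef_nonvertex. Qed.

Lemma coef_right_vertex (x : X) v : vertices M v -> coef (bary x) v = 0.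
Proof. by move=> Mv; apply: coef_nonvertex => /disjoint_vertices. Qed.

(** The two predicates tell apart the images of the three kinds of cylinder points: only the open
    tube meets both sides. *)
Definition meets_left (w : J) :=
  exists2 v, vertices K v & coef (bary w) v != 0.
Definition meets_right (w : J) :=
  exists2 v, vertices M v & coef (bary w) v != 0.

Lemma inL_meets_right x : ~ meets_right (sum_to_join (inL x)).
Proof. by move=> [v Mv]; rewrite bary_inclusion coef_right_vertex ?eqxx. Qed.

Lemma inR_meets_left y : ~ meets_left (sum_to_join (inR y)).
Proof. by move=> [v Kv]; rewrite bary_inclusion coef_left_vertex ?eqxx. Qed.

Lemma inR_meets_right y : meets_right (sum_to_join (inR y)).
Proof. exact: exists_coef_neq0. Qed.

Lemma tube_meets_left z i : val i != 1 -> meets_left (sum_to_join (tube z i)).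
Proof.
move=> i1; have [v Kv xv] := exists_coef_neq0 (components z).1.
exists v => //; rewrite coef_segment /segment_coef /= (coef_left_vertex _ Kv).
by rewrite mulr0 addr0 mulf_neq0 // subr_eq0 eq_sym.
Qed.

Lemma tube_meets_right z i : val i != 0 -> meets_right (sum_to_join (tube z i)).
Proof.
move=> i0; have [v Mv yv] := exists_coef_neq0 (components z).2.
exists v => //; rewrite coef_segment /segment_coef /= (coef_right_vertex _ Mv).
by rewrite mulr0 add0r mulf_neq0.
Qed.

(** Normal forms modulo gluing: the ends of the tube are absorbed into the two bases, leaving only
    the open tube. *)
Variant cylinder_spec (a : S) : Prop :=
  | CylinderLeft x of glued a (inL x)
  | CylinderRight y of glued a (inR y)
  | CylinderTube z i of a = tube z i & val i != 0 & val i != 1.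

Lemma cylinderP a : cylinder_spec a.
Proof.
case: a => -[[x|y]|[z i]].
- by apply: (@CylinderLeft _ x); exact: rst_refl.
- by apply: (@CylinderRight _ y); exact: rst_refl.
have [i0|i0] := eqVneq (val i) 0.
  by apply: CylinderLeft; apply: rst_step; exact: glue_left.
have [i1|i1] := eqVneq (val i) 1.
  by apply: CylinderRight; apply: rst_step; exact: glue_right.
exact: CylinderTube i0 i1.
Qed.

(** On the vertices of [M] only the second summand survives, and its total mass gives back [i].
    Subtracting it isolates the first summand. Both weights are nonzero inside the tube, so the
    endpoints agree. *)
Lemma segment_inj z z' i i' : val i != 0 -> val i != 1 ->
  segment (z, i) = segment (z', i') -> z = z' /\ i = i'.
Proof.
move=> i0 i1 /(congr1 (coef \o bary)) /=.
rewrite !coef_segment => /(congr1 (@^~ _)) E.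
have Er v : val i * coef (bary (components z).2) v =
            val i' * coef (bary (components z').2) v.
  (* At a vertex of [K] both sides vanish by disjointness; at any other [v] the [K] terms drop out
     of [E]. *)
  have [Kv|nKv] := pselect (vertices K v).
    by rewrite !coef_left_vertex // !mulr0.
  have := E v.
  by rewrite /segment_coef /= !(coef_nonvertex _ nKv) !mulr0 !add0r.
have [ii' y] := scaled_coef_inj Er.
have El v : (1 - val i) * coef (bary (components z).1) v =
            (1 - val i') * coef (bary (components z').1) v.
  by have := E v; rewrite /segment_coef /= Er => /addIr.
have [_ x] := scaled_coef_inj El.
split; last exact: val_inj.
apply: components_inj; rewrite [components z]surjective_pairing.
by rewrite x ?subr_eq0 1?eq_sym // y.
Qed.

(** Mixed pairs of normal forms are excluded by the vertices that their images meet; pairs of one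
    kind reduce to injectivity of [bary] or of [segment] on the open tube. *)
Lemma sum_to_join_inj a b : sum_to_join a = sum_to_join b -> glued a b.
Proof.
move=> ab.
have refl c d : c = d -> glued c d by move=> ->; exact: rst_refl.
(* [trans] replaces each argument by a glued normal form, which does not change its image. *)
have trans a' b' : glued a a' -> glued b b' ->
    (sum_to_join a' = sum_to_join b' -> glued a' b') -> glued a b.
  move=> aa' bb' inj; apply: (rst_trans _ _ _ a') => //.
  apply: (rst_trans _ _ _ b'); last exact: rst_sym.
  by apply: inj; rewrite -(sum_to_join_glue aa') -(sum_to_join_glue bb').
case: (cylinderP a) => [x ax|y ay|z i az i0 i1];
case: (cylinderP b) => [x' bx|y' by'|z' i' bz i0' i1'].
- apply: trans ax bx _ => /(congr1 bary) xx.
  have -> : x = x' by exact: bary_inj.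
  exact: rst_refl.
- apply: trans ax by' _ => xy; have := inR_meets_right y'.
  by rewrite -xy => /inL_meets_right.
- apply: (trans _ _ ax (refl _ _ bz)) => xy; have := tube_meets_right z' i0'.
  by rewrite -xy => /inL_meets_right.
- apply: trans ay bx _ => xy; have := inR_meets_right y.
  by rewrite xy => /inL_meets_right.
- apply: trans ay by' _ => /(congr1 bary) yy.
  have -> : y = y' by exact: bary_inj.
  exact: rst_refl.
- apply: (trans _ _ ay (refl _ _ bz)) => xy; have := tube_meets_left z' i1'.
  by rewrite -xy => /inR_meets_left.
- apply: (trans _ _ (refl _ _ az) bx) => xy; have := tube_meets_right z i0.
  by rewrite xy => /inL_meets_right.
- apply: (trans _ _ (refl _ _ az) by') => xy; have := tube_meets_left z i1.
  by rewrite xy => /inR_meets_left.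
- apply: (trans _ _ (refl _ _ az) (refl _ _ bz)) => /segment_inj[] // -> ->.
  exact: rst_refl.
Qed.

Lemma cylinder_to_join_inj : injective cylinder_to_join.
Proof.
move=> d d'; rewrite -[d]reprK -[d']reprK !cylinder_to_join_pi.
by move=> /sum_to_join_inj/piE.
Qed.

(** * Surjectivity and closedness of the map *)

Lemma segment_onto s t (w : J) : related_simplices Rel s t ->
    closed_simplex R L (s `|` t)%fset w ->
  exists2 zi, cell Rel s t zi.1 & segment zi = w.
Proof.
move=> Rst ws; have [Ks Mt] := related_simplicesW Rst.
have st v : v \in s -> v \notin t.
  move=> vs; apply/negP => vt.
  by have /disjoint_vertices : vertices K v; [exists s | apply; exists t].
(* If [w] has no mass on one side, the endpoint there is arbitrary in its simplex, so the ends of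
   the tube are covered and the preimage still lies over [cell s t]. *)
have [x xs xE] := exists_normalized Ks (coef_ge0 w).
have [y yt yE] := exists_normalized Mt (coef_ge0 w).
have [z zE] := exists_components (xy := (x, y)) Rst (conj xs yt).
(* The masses of [w] on the two sides add up to 1, so [mt] is the time parameter and [ms] the weight
   of [x]. *)
set ms := \sum_(v <- s) _ in xE; set mt := \sum_(v <- t) _ in yE.
have mst : 1 - mt = ms.
  by rewrite -(sum_coef1 ws) big_fsetU_disjoint // addrK.
have ms0 : 0 <= ms by apply: sumr_ge0 => v _; exact: coef_ge0.
have mt0 : 0 <= mt by apply: sumr_ge0 => v _; exact: coef_ge0.
have mt01 : `[0, 1]%classic mt by rewrite /= in_itv /= mt0 -subr_ge0 mst.
exists (z, exist _ mt (mem_set mt01) : I).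
  by rewrite /= /cell /preimage /= zE.
apply/bary_inj/coef_inj; rewrite coef_segment; apply/funext => v.
rewrite /segment_coef zE /= mst.
have [vs|vs] := boolP (v \in s).
  by rewrite xE // (coef_eq0 yt (st _ vs)) mulr0 addr0.
rewrite (coef_eq0 xs vs) mulr0 add0r.
have [vt|vt] := boolP (v \in t); first by rewrite yE.
by rewrite (coef_eq0 yt vt) (coef_eq0 ws) ?mulr0 // inE negb_or vs.
Qed.

Lemma cylinder_to_join_surj w : exists d, cylinder_to_join d = w.
Proof.
have wL := supp_simplex w; have ww := fsubset_refl (supp (bary w)).
have sub (P : simplicial_complex V) : simplices P (supp (bary w)) ->
    exists x : realization R P, bary x = bary w.
  move=> Pw; have [||x xE _] := realizationP (K := P) Pw (coef_ge0 w).
  - by move=> v; exact: coef_eq0.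
  - exact: sum_coef1.
  by exists x; exact: coef_inj.
case: wL => [[/sub[x xE]|/sub[y yE]]|[p Rp pE]].
- by exists (\pi_D (inL x)); rewrite cylinder_to_join_pi; exact: bary_inj.
- by exists (\pi_D (inR y)); rewrite cylinder_to_join_pi; exact: bary_inj.
have Rst : related_simplices Rel (val p.1) (val p.2) by exists p.
have [|[z i] _ zi] := @segment_onto _ _ w Rst; first by rewrite pE.
by exists (\pi_D (tube z i)); rewrite cylinder_to_join_pi.
Qed.

(* On the simplex [s `|` t] the image is that of a closed part of the compact
   set [cell s t * I], which is how closedness survives at the ends of the
   tube, where the join coordinates degenerate. *)
Lemma cylinder_to_join_closed (C : set D) :
  closed C -> closed (cylinder_to_join @` C).
Proof.
move=> cC.
(* [pre] pulls the image back along one piece of the disjoint union; by injectivity this is the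
   preimage of [C] under the quotient map composed with [f]. *)
have pre (T : topologicalType) (f : T -> S) : continuous f ->
    closed ((sum_to_join \o f) @^-1` (cylinder_to_join @` C)).
  move=> cf; have -> : (sum_to_join \o f) @^-1` (cylinder_to_join @` C) =
      (\pi_D \o f) @^-1` C.
    apply/seteqP; split=> a /=; last first.
      by exists (\pi_D (f a)) => //; rewrite cylinder_to_join_pi.
    by move=> [d Cd]; rewrite -cylinder_to_join_pi => /cylinder_to_join_inj <-.
  apply: preimage_closed cC => a _.
  by apply: continuous_comp; [exact: cf | exact: pi_continuous].
apply/closed_realizationP => s0 [[Ks|Ms]|[p Rp <-]].
- rewrite (image_inclusion join_left) //.
  apply: (closed_realizationP _).1 => //.
  exact: (pre _ inL (@existT_continuous _ _ (Some true))).
- rewrite (image_inclusion join_right) //.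
  apply: (closed_realizationP _).1 => //.
  exact: (pre _ inR (@existT_continuous _ _ (Some false))).
set s := val p.1; set t := val p.2.
have Rst : related_simplices Rel s t by exists p.
have -> : cylinder_to_join @` C `&` closed_simplex R L (s `|` t)%fset =
    segment @` ((cell Rel s t `*` setT)
      `&` segment @^-1` (cylinder_to_join @` C)).
  apply/seteqP; split=> [w [Cw ws]|_ [[z i] [[zst _] Czi] <-]]; last first.
    by split=> //; exact: segment_cell.
  have [zi zist ziw] := segment_onto Rst ws.
  by exists zi => //; split=> //; rewrite /preimage /= ziw.
rewrite image_comp.
apply: compact_closed; first exact: barycentric_hausdorff.
apply: continuous_compact.
  exact/continuous_subspaceT/bary_segment_continuous.
apply: compact_closedI.
  by apply: compact_setX; [exact: compact_cell | exact: unit_interval_compact].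
exact: (pre _ _ (@existT_continuous _ (cylinder_piece R Z X Y) None)).
Qed.

End CylinderToJoin.

(** * Assembling the homeomorphism *)

Theorem theorem4p1 (R : realType) (V : choiceType)
    (K M : simplicial_complex V)
    (disjointKM : vertices K `&` vertices M = set0)
    (Rel : poset_relation (face_poset K) (face_poset M)) :
  homeomorphic (realization R (relational_join Rel))
    (double_mapping_cylinder R (proj_left R Rel) (proj_right R Rel)).
Proof.
have [g gK] := choice (@cylinder_to_join_surj R V K M Rel disjointKM).
pose f := @cylinder_to_join R V K M Rel.
have fK : cancel f g.
  by move=> d; apply: (cylinder_to_join_inj disjointKM); exact: gK.
exists g, f; split=> //; last exact: cylinder_to_join_continuous.
apply/continuous_closedP => C cC.
(* Preimages under the inverse [g] are images under [f], so closedness of the map [f] gives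
   continuity of [g]. *)
have -> : g @^-1` C = f @` C.
  apply/seteqP; split=> [w Cw|_ [d Cd <-]]; first by exists (g w).
  by rewrite /preimage /= fK.
exact: cylinder_to_join_closed.
Qed.
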